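(* Let $\mathcal{X}$ be a $*$-algebra with unit element $1$ and let $\mathcal{B}$ be a $*$-algebra (not necessarily unital), both over $\mathbb{C}$, with involutions denoted by $x\mapsto x^+$ and $b\mapsto b^+$. Let $\triangleright:\mathcal{X}\otimes\mathcal{B}\to\mathcal{B}$ be a left action of $\mathcal{X}$ on the vector space $\mathcal{B}$, and suppose that $$(x\triangleright a)^+\,b=a^+\,(x^+\triangleright b)\qquad\text{for all }x\in\mathcal{X},\ a,b\in\mathcal{B}.$$ Then for every non-degenerate $*$-representation $\rho$ of $\mathcal{B}$ with domain $\mathcal{D}(\rho)$ there exists a unique $*$-representation $\tilde\rho$ of $\mathcal{X}$ on the domain $\mathcal{D}(\tilde\rho)=\rho(\mathcal{B})\mathcal{D}(\rho):=\operatorname{span}\{\rho(b)\varphi: b\in\mathcal{B},\ \varphi\in\mathcal{D}(\rho)\}$ such that $$\tilde\rho(x)(\rho(b)\varphi)=\rho(x\triangleright b)\varphi\qquad\text{for all }x\in\mathcal{X},\ b\in\mathcal{B},\ \varphi\in\mathcal{D}(\rho).$$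
   Context: Left action: a linear map $\mathcal{X}\otimes\mathcal{B}\to\mathcal{B}$, $x\otimes b\mapsto x\triangleright b$, such that $(xy)\triangleright b=x\triangleright(y\triangleright b)$ and $1\triangleright b=b$ for all $x,y\in\mathcal{X}$, $b\in\mathcal{B}$ (only the vector space structure of $\mathcal{B}$ is involved here). For a dense linear subspace $\mathcal{D}$ of a complex Hilbert space $\mathcal{H}$, let $\mathcal{L}^+(\mathcal{D})$ be the set of all linear maps $x:\mathcal{D}\to\mathcal{D}$ such that $\mathcal{D}$ is contained in the domain of the adjoint operator $x^*$ and $x^*\mathcal{D}\subseteq\mathcal{D}$. It is a unital $*$-algebra with the operator product and the involution $x^+:=x^*|_{\mathcal{D}}$. A $*$-representation of a $*$-algebra $A$ (unital or not) on the domain $\mathcal{D}$ is a $*$-homomorphism $\rho:A\to\mathcal{L}^+(\mathcal{D})$; we write $\mathcal{D}(\rho)=\mathcal{D}$. It is called non-degenerate if (the linear span of) $\rho(A)\mathcal{D}$ is dense in $\mathcal{H}$. *)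

(* Defs.v *)
From HB Require Import structures.
From mathcomp Require Import all_boot all_order all_algebra sesquilinear.
From mathcomp Require Import boolp classical_sets functions reals.
From mathcomp Require Import topology normedtype.
From mathcomp Require Export complex.

Set Implicit Arguments.
Unset Strict Implicit.
Unset Printing Implicit Defensive.

Import Order.TTheory GRing.Theory Num.Theory numFieldNormedType.Exports.
Local Open Scope classical_set_scope.
Local Open Scope ring_scope.

(* MathComp's algType is unital and nontrivial, so *-algebras (possibly without
   unit, possibly zero) are built directly on top of C-vector spaces. *)
HB.mixin Record isStarAlgebra (C : numClosedFieldType) A
    & GRing.Lmodule C A := {
  smul : A -> A -> A;
  star : A -> A;
  smulA : associative smul;
  smul_bilinear : bilinear_for *:%R *:%R smul;
  star_conjlinear :
    forall (a : C) (x y : A), star (a *: x + y) = a^* *: star x + star y;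
  starM : forall x y : A, star (smul x y) = smul (star y) (star x);
  starK : involutive star;
}.

#[short(type="starAlgType")]
HB.structure Definition StarAlgebra (C : numClosedFieldType) :=
  {A of GRing.Lmodule C A & isStarAlgebra C A}.

HB.mixin Record StarAlgebra_isUnital (C : numClosedFieldType) A
    & StarAlgebra C A := {
  sone : A;
  smul1l : left_id sone (@smul C A);
  smul1r : right_id sone (@smul C A);
}.

#[short(type="unitalStarAlgType")]
HB.structure Definition UnitalStarAlgebra (C : numClosedFieldType) :=
  {A of StarAlgebra C A & StarAlgebra_isUnital C A}.

Declare Scope star_scope.
Delimit Scope star_scope with star.
Infix "**" := smul (at level 40, left associativity) : star_scope.
Local Open Scope star_scope.

Section Morphism.
Variables (C : numClosedFieldType) (A B : starAlgType C).

(* No condition on units, even if both algebras have one. *)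
Definition star_morphism (f : A -> B) :=
  [/\ linear f,
      forall x y, f (x ** y) = f x ** f y &
      forall x, f (star x) = star (f x)].

End Morphism.

(* The inner product is linear in its first argument. *)
HB.mixin Record NormedModule_isHilbert (C : numClosedFieldType) H
    & CompleteNormedModule C H := {
  inner : {dot H for (@Num.conj C)};
  inner_norm : forall u : H, inner u u = `|u| ^+ 2;
}.

#[short(type="hilbertType")]
HB.structure Definition Hilbert (C : numClosedFieldType) :=
  {H of CompleteNormedModule C H & NormedModule_isHilbert C H}.

Notation "''<' u , v >" := (inner u%R v%R)
  (at level 2, u at level 60, v at level 60, format "''<' u ,  v >")
  : ring_scope.

Section InnerTheory.
Variables (C : numClosedFieldType) (H : hilbertType C).
Implicit Types (u v w : H) (a : C).

Lemma innerC u v : '<u, v> = ('<v, u>)^*.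
Proof. by have := hermC (@inner C H) u v; rewrite expr0 mul1r. Qed.

Lemma innerPl a u v w : '<a *: u + v, w> = a * '<u, w> + '<v, w>.
Proof. exact: linearPl. Qed.

Lemma innerPr a u v w : '<w, a *: u + v> = a^* * '<w, u> + '<w, v>.
Proof. exact: linearPr. Qed.

Lemma inner0l u : '<0, u> = 0. Proof. exact: linear0l. Qed.

Lemma inner0r u : '<u, 0> = 0. Proof. exact: linear0r. Qed.

Lemma innerBr u v w : '<w, u - v> = '<w, u> - '<w, v>.
Proof. exact: linearBr. Qed.

Lemma inner_subsq u v : '<u, v> = 0 -> '<u - v, u - v> = '<u, u> + '<v, v>.
Proof. exact: (@hnormBd _ _ _ _ (@inner C H)). Qed.

End InnerTheory.

Definition linear_span (C : numClosedFieldType) (V : lmodType C) (S : set V) :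
    set V :=
  [set v | exists n (a : 'I_n -> C) (s : 'I_n -> V),
     (forall i, S (s i)) /\ v = \sum_(i < n) a i *: s i].

Lemma linear_span_submod (C : numClosedFieldType) (V : lmodType C) (S : set V) :
  submod_closed (mem (linear_span S)).
Proof.
split; first by apply/mem_set; exists 0%N, (fun=> 0), (fun=> 0);
  rewrite big_ord0; split=> // -[].
move=> c _ _ /set_mem[n [a [s [Ss ->]]]] /set_mem[m [b [t [St ->]]]].
apply/mem_set; exists (n + m)%N,
  (fun i => match fintype.split i with inl j => c * a j | inr j => b j end),
  (fun i => match fintype.split i with inl j => s j | inr j => t j end).
split=> [i|]; first by case: fintype.split.
rewrite big_split_ord /= scaler_sumr; congr (_ + _); apply: eq_bigr => i _.
  by case: (fintype.split _) (unsplitK (inl i : 'I_n + 'I_m)) => j // [->]; rewrite scalerA.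
by case: (fintype.split _) (unsplitK (inr i : 'I_n + 'I_m)) => j // [->].
Qed.

Record denseSubspace (C : numClosedFieldType) (H : hilbertType C) :=
  DenseSubspace {
    dset :> set H;
    dset_submod : submod_closed (mem dset);
    dset_dense : dense dset }.

Section Domain.
Variables (C : numClosedFieldType) (H : hilbertType C) (D : denseSubspace H).

Record domain := Domain { dval :> H; dvalP : dval \in dset D }.

HB.instance Definition _ := [isSub for dval].
HB.instance Definition _ := [Choice of domain by <:].
HB.instance Definition _ := GRing.SubChoice_isSubLmodule.Build C H _ domain
  (GRing.submod_closed_semi (dset_submod D)).

Implicit Types x y : domain -> domain.

Definition adjoint_at x (psi eta : H) :=
  forall phi : domain, '<(x phi : H), psi> = '<(phi : H), eta>.

Definition adjoint_dom x : set H := [set psi | exists eta, adjoint_at x psi eta].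

Definition Lplus_set : set (domain -> domain) :=
  [set x | [/\ linear x, dset D `<=` adjoint_dom x &
     forall psi eta, dset D psi -> adjoint_at x psi eta -> dset D eta]].

Record Lplus := MkLplus { op :> domain -> domain; opP : op \in Lplus_set }.

HB.instance Definition _ := [isSub for op].
HB.instance Definition _ := [Choice of Lplus by <:].

Lemma dense_inner_eq0 (d : H) :
  (forall phi : domain, '<(phi : H), d> = 0) -> d = 0.
Proof.
move=> d0; apply/eqP; apply: contraT => dn0.
have n0 : 0 < `|d| by rewrite normr_gt0.
have [||phi [dphi Dphi]] := @dset_dense _ _ D (ball d `|d|).
- by exists d; exact: ballxx.
- exact: ball_open.
have phid := d0 (Domain (mem_set Dphi)); rewrite /= in phid.
move: dphi; rewrite -ball_normE /= -(@ltr_pXn2r _ 2) ?nnegrE//.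
have dphi0 : '<d, phi> = 0 by rewrite innerC phid rmorph0.
rewrite -!inner_norm inner_subsq// gtrDl inner_norm.
by rewrite le_gtF ?exprn_ge0.
Qed.

Lemma adjoint_unique x psi eta1 eta2 :
  adjoint_at x psi eta1 -> adjoint_at x psi eta2 -> eta1 = eta2.
Proof.
move=> h1 h2; apply/eqP; rewrite -subr_eq0; apply/eqP.
by apply: dense_inner_eq0 => phi; rewrite innerBr/= -h1 -h2 subrr.
Qed.

Lemma Lplus_adjoint (x : Lplus) (psi : domain) :
  {eta : domain | adjoint_at x psi eta}.
Proof.
apply: cid; have [_ + inD] := set_mem (opP x).
case: psi => psi /= /[dup] psiD /set_mem psiD' /(_ _ psiD')[eta xeta].
by exists (Domain (mem_set (inD _ _ psiD' xeta))).
Qed.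

(* The restriction of the adjoint of x to D. *)
Definition adj (x : Lplus) : domain -> domain := fun psi => sval (Lplus_adjoint x psi).

Lemma adjE (x : Lplus) (phi psi : domain) :
  '<(x phi : H), (psi : H)> = '<(phi : H), (adj x psi : H)>.
Proof. exact: (svalP (Lplus_adjoint x psi)). Qed.

Lemma adjEr (x : Lplus) (phi psi : domain) :
  '<(adj x phi : H), (psi : H)> = '<(phi : H), (x psi : H)>.
Proof. by rewrite innerC -adjE -innerC. Qed.

Lemma domain_inj (u v : domain) :
  (forall phi : domain, '<(phi : H), (u : H)> = '<(phi : H), (v : H)>) -> u = v.
Proof.
move=> uv; apply/val_inj/eqP; rewrite -subr_eq0; apply/eqP.
by apply: dense_inner_eq0 => phi; rewrite innerBr/= uv subrr.
Qed.

Lemma formal_adjoint x y : linear x ->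
  (forall phi psi : domain, '<(x phi : H), (psi : H)> = '<(phi : H), (y psi : H)>) ->
  x \in Lplus_set.
Proof.
move=> xl xy; apply/mem_set; split=> // [psi Dpsi|psi eta Dpsi xeta].
  by exists (y (Domain (mem_set Dpsi))) => phi; rewrite -xy.
have -> : eta = y (Domain (mem_set Dpsi)).
  by apply: (adjoint_unique xeta) => phi; rewrite -xy.
exact/set_mem/dvalP.
Qed.

Lemma Lplus_linear (x : Lplus) : linear x.
Proof. by case: (set_mem (opP x)). Qed.

Lemma Lplus_submod : GRing.subsemimod_closed (mem Lplus_set).
Proof.
apply: GRing.submod_closed_semi; split.
  apply: (@formal_adjoint _ (fun=> 0)) => [a u v|phi psi] /=.
    by rewrite scaler0 addr0.
  by rewrite inner0l inner0r.
move=> a x y xL yL; pose X := MkLplus xL; pose Y := MkLplus yL.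
apply: (@formal_adjoint _ (fun psi => a^* *: adj X psi + adj Y psi)).
  move=> b u v; rewrite !fctE -[x]/(op X) -[y]/(op Y) !Lplus_linear.
  by rewrite !scalerDr !scalerA mulrC addrACA.
move=> phi psi; rewrite /= innerPl innerPr/= -!adjE/=.
by rewrite conjCK.
Qed.

HB.instance Definition _ :=
  GRing.SubChoice_isSubLmodule.Build C (domain -> domain) _ Lplus Lplus_submod.

Lemma Lplus_comp (x y : Lplus) : (x \o y : domain -> domain) \in Lplus_set.
Proof.
apply: (@formal_adjoint _ (adj y \o adj x)) => [a u v|phi psi] /=.
  by rewrite !Lplus_linear.
by rewrite !adjE.
Qed.

Lemma Lplus_adj (x : Lplus) : adj x \in Lplus_set.
Proof.
apply: (@formal_adjoint _ x) => [a u v|]; last exact: adjEr.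
by apply: domain_inj => phi; rewrite -adjE/= !innerPr/= -!adjE.
Qed.

Lemma Lplus_id : (idfun : domain -> domain) \in Lplus_set.
Proof. exact: (@formal_adjoint _ idfun). Qed.

Definition Lplus_mul (x y : Lplus) := MkLplus (Lplus_comp x y).
Definition Lplus_star (x : Lplus) := MkLplus (Lplus_adj x).

Lemma LplusP (x y : Lplus) : op x =1 op y -> x = y.
Proof. by move=> xy; apply/val_inj/funext. Qed.

Lemma Lplus_mulA : associative Lplus_mul.
Proof. by move=> x y z; apply: LplusP. Qed.

Lemma Lplus_mul_bilinear : bilinear_for *:%R *:%R Lplus_mul.
Proof.
split=> [y|x] a u v; apply: LplusP => phi //=.
exact: Lplus_linear.
Qed.

Lemma Lplus_star_conjlinear (a : C) (x y : Lplus) :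
  Lplus_star (a *: x + y) = a^* *: Lplus_star x + Lplus_star y.
Proof.
apply: LplusP => psi /=; apply: domain_inj => phi.
by rewrite -adjE/= innerPl innerPr/= conjCK -!adjE.
Qed.

Lemma Lplus_starM (x y : Lplus) :
  Lplus_star (Lplus_mul x y) = Lplus_mul (Lplus_star y) (Lplus_star x).
Proof.
by apply: LplusP => psi /=; apply: domain_inj => phi; rewrite -!adjE.
Qed.

Lemma Lplus_starK : involutive Lplus_star.
Proof.
by move=> x; apply: LplusP => psi /=; apply: domain_inj => phi; rewrite -adjE /= adjEr.
Qed.

HB.instance Definition _ := isStarAlgebra.Build C Lplus Lplus_mulA
  Lplus_mul_bilinear Lplus_star_conjlinear Lplus_starM Lplus_starK.

Lemma Lplus_1l : left_id (MkLplus Lplus_id) Lplus_mul.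
Proof. by move=> x; apply: LplusP. Qed.

Lemma Lplus_1r : right_id (MkLplus Lplus_id) Lplus_mul.
Proof. by move=> x; apply: LplusP. Qed.

HB.instance Definition _ :=
  StarAlgebra_isUnital.Build C Lplus Lplus_1l Lplus_1r.

End Domain.

Record starRep (C : numClosedFieldType) (H : hilbertType C)
    (A : starAlgType C) (D : denseSubspace H) := StarRep {
  rep :> A -> Lplus D;
  rep_morphism : star_morphism rep }.

Section Range.
Variables (C : numClosedFieldType) (H : hilbertType C) (A : starAlgType C).
Variables (D : denseSubspace H) (rho : starRep A D).

Definition rep_range : set H :=
  linear_span [set v : H | exists b (phi : domain D), v = rho b phi].

Definition nondegenerate_rep := dense rep_range.

Hypothesis rho_nd : nondegenerate_rep.

Definition rep_range_domain : denseSubspace H :=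
  DenseSubspace (linear_span_submod _) rho_nd.

Lemma rep_range_gen b (phi : domain D) : dval (rho b phi) \in rep_range.
Proof.
apply/mem_set; exists 1%N, (fun=> 1), (fun=> dval (rho b phi)).
by split=> [i|]; [exists b, phi | rewrite big_ord1 scale1r].
Qed.

(* rho b phi, as an element of the domain span (rho A D). *)
Definition range_elt b (phi : domain D) : domain rep_range_domain :=
  Domain (D := rep_range_domain) (rep_range_gen b phi).

End Range.

(* Main.v *)
Require Import Defs.
From HB Require Import structures.
From mathcomp Require Import all_boot all_order all_algebra sesquilinear.
From mathcomp Require Import boolp classical_sets functions reals.
From mathcomp Require Import topology normedtype.
Local Open Scope ring_scope.
Local Open Scope star_scope.

(** The compatibility of the action with the involutions gives
    <rho(x |> a) phi, rho(b) psi> = <rho(a) phi, rho(x^+ |> b) psi>.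
    Hence for v in the dense span of rho(B)D the vector
    w = sum_i rho(x |> b_i) phi_i attached to a decomposition
    v = sum_i rho(b_i) phi_i is determined by
    <w, rho(b) psi> = <v, rho(x^+ |> b) psi> for all b and psi, an equation
    that does not involve the decomposition.  The operator rhot(x) is defined
    by this equation, and all its properties follow from uniqueness of w. *)

Import GRing.Theory Num.Theory.

Section RangeTheory.
Context {C : numClosedFieldType} {H : hilbertType C} {A : starAlgType C}.
Context {D : denseSubspace H} {rho : starRep A D}.
Context (rho_nd : nondegenerate_rep rho).
Local Notation E := (domain (rep_range_domain rho_nd)).
Local Notation elt := (range_elt rho_nd).

Lemma range_elt_linear (a : C) (b c : A) (phi : domain D) :
  elt (a *: b + c) phi = a *: elt b phi + elt c phi.
Proof.
apply: val_inj; rewrite /=.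
by have [-> _ _] := rep_morphism rho.
Qed.

Lemma range_elt_ind (P : E -> Prop) :
    P 0 -> (forall a u v, P u -> P v -> P (a *: u + v)) ->
    (forall b phi, P (elt b phi)) -> forall v, P v.
Proof.
move=> P0 PD Pelt v.
have /set_mem[n [a [s [Ss vE]]]] := dvalP v.
(* The [s i] are vectors of [H]; each is lifted to a generator in [E], so that the decomposition of
   [v] can be read inside [E], where [P] lives. *)
have /choice[t tE] : forall i, exists u : E, P u /\ dval u = s i.
  by move=> i; have [b [phi ->]] := Ss i; exists (elt b phi).
have -> : v = \sum_(i < n) a i *: t i.
  apply: val_inj; rewrite [LHS]vE raddf_sum; apply: eq_bigr => i _ /=.
  by have [_ ->] := tE i.
elim/big_rec: _ => // i u _ Pu; apply: PD => //.
by have [] := tE i.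
Qed.

Lemma Lplus_range_ext (f g : Lplus (rep_range_domain rho_nd)) :
  (forall b phi, f (elt b phi) = g (elt b phi)) -> f = g.
Proof.
have op0 (h : Lplus (rep_range_domain rho_nd)) : h 0 = 0.
  (* With the scalar -1, linearity at 0 reads h 0 = - h 0 + h 0. *)
  by have := Lplus_linear h (-1) 0 0; rewrite scaler0 addr0 scaleN1r addNr.
move=> fg; apply: LplusP; apply: range_elt_ind => [|a u v fgu fgv|//].
  by rewrite !op0.
by rewrite !Lplus_linear fgu fgv.
Qed.

(** The uniqueness of w: generators span [E], and [E] is dense, so pairings with generators separate
    points. *)
Lemma inner_range_inj (u v : E) :
  (forall b phi, '<(u : H), (elt b phi : H)> = '<(v : H), (elt b phi : H)>) ->
  u = v.
Proof.
move=> uv; apply: domain_inj; apply: range_elt_ind => [|a w z wE zE|b phi].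
- by rewrite /= !inner0l.
- by rewrite /= !innerPl wE zE.
- by rewrite innerC uv -innerC.
Qed.

(** Pairings of generators see a and b only through a^+ b, the expression that the compatibility
    condition rewrites. *)
Lemma inner_range_elt (a b : A) (phi psi : domain D) :
  '<(elt a phi : H), (elt b psi : H)> =
  '<(phi : H), (rho (star a ** b) psi : H)>.
Proof.
have [_ rhoM rhoS] := rep_morphism rho.
by rewrite rhoM rhoS /= adjE.
Qed.

End RangeTheory.

Lemma starRepP {C : numClosedFieldType} {H : hilbertType C} {A : starAlgType C}
  {D : denseSubspace H} (r s : starRep A D) : rep r =1 rep s -> r = s.
Proof.
case: r s => [r rM] [s sM] /= /funext rs.
by case: s / rs in sM *; congr StarRep; apply: Prop_irrelevance.
Qed.

Section InducedRep.
Context {C : numClosedFieldType} {X : unitalStarAlgType C} {B : starAlgType C}.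
Context {act : {bilinear X -> B -> B}}.
Context {H : hilbertType C} {D : denseSubspace H}.
Context {rho : starRep B D} (rho_nd : nondegenerate_rep rho).
Hypothesis actM : forall (x y : X) (b : B), act (x ** y) b = act x (act y b).
Hypothesis act_star : forall (x : X) (a b : B),
  star (act x a) ** b = star a ** act (star x) b.
Local Notation E := (domain (rep_range_domain rho_nd)).
Local Notation elt := (range_elt rho_nd).

Lemma inner_act x a b (phi psi : domain D) :
  '<(elt (act x a) phi : H), (elt b psi : H)> =
  '<(elt a phi : H), (elt (act (star x) b) psi : H)>.
Proof. by rewrite !inner_range_elt act_star. Qed.

Definition induced_at (x : X) (v w : E) := forall b psi,
  '<(w : H), (elt b psi : H)> = '<(v : H), (elt (act (star x) b) psi : H)>.

(** Serves twice: to carry existence of w from generators to their span, and to make [induced_fun]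
    linear. *)
Lemma induced_at_linear x a u v u' v' :
  induced_at x u u' -> induced_at x v v' ->
  induced_at x (a *: u + v) (a *: u' + v').
Proof. by move=> uu' vv' b psi; rewrite /= !innerPl uu' vv'. Qed.

Lemma induced_at_ex x v : {w | induced_at x v w}.
Proof.
(* Choice comes first, because the induction principle only proves propositions. *)
apply: cid; move: v; apply: range_elt_ind => [|a u v [u' uu'] [v' vv']|b phi].
- by exists 0 => b psi; rewrite /= !inner0l.
- by exists (a *: u' + v'); apply: induced_at_linear.
- by exists (elt (act x b) phi) => c psi; rewrite inner_act.
Qed.

Definition induced_fun (x : X) (v : E) : E := sval (induced_at_ex x v).

Lemma induced_funP x v : induced_at x v (induced_fun x v).
Proof. exact: svalP. Qed.

Lemma induced_funE x v w : induced_at x v w -> induced_fun x v = w.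
Proof.
by move=> vw; apply: inner_range_inj => b psi; rewrite induced_funP vw.
Qed.

Lemma induced_fun_elt x b phi :
  induced_fun x (elt b phi) = elt (act x b) phi.
Proof. by apply: induced_funE => c psi; rewrite inner_act. Qed.

Lemma induced_fun_linear x : linear (induced_fun x).
Proof.
move=> a u v; apply: induced_funE.
by apply: induced_at_linear; apply: induced_funP.
Qed.

(** For v a generator this is the equation defining rhot(x); conjugate linearity in v does the rest.
    It puts rhot(x) in L^+ of the span, with adjoint rhot(x^+). *)
Lemma induced_fun_adjoint x (u v : E) :
  '<(induced_fun x u : H), (v : H)> = '<(u : H), (induced_fun (star x) v : H)>.
Proof.
move: v; apply: range_elt_ind => [|a v w vE wE|b psi].
- have -> : induced_fun (star x) 0 = 0.
    by apply: induced_funE => b psi; rewrite /= !inner0l.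
  by rewrite /= !inner0r.
- by rewrite induced_fun_linear /= !innerPr vE wE.
- by rewrite induced_fun_elt induced_funP.
Qed.

Definition induced_op x : Lplus (rep_range_domain rho_nd) :=
  MkLplus (formal_adjoint (@induced_fun_linear x) (induced_fun_adjoint x)).

Lemma induced_op_morphism : star_morphism induced_op.
Proof.
split=> [a x y|x y|x].
- apply: Lplus_range_ext => b phi.
  by rewrite /= !fctE !induced_fun_elt linearPl range_elt_linear.
- apply: Lplus_range_ext => b phi.
  by rewrite /= !induced_fun_elt actM.
(* Both rhot(x^+) and the adjoint of rhot(x) move across the inner product to rhot(x) on the
   left. *)
- apply: LplusP => v; apply: domain_inj => u.
  by rewrite -adjE -induced_fun_adjoint.
Qed.

Definition induced_rep : starRep X (rep_range_domain rho_nd) :=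
  StarRep induced_op_morphism.

End InducedRep.

Theorem proposition1 (R : realType)
    (X : unitalStarAlgType R[i]) (B : starAlgType R[i])
    (act : {bilinear X -> B -> B})
    (actM : forall (x y : X) (b : B), act (x ** y) b = act x (act y b))
    (act1 : forall b : B, act sone b = b)
    (act_star : forall (x : X) (a b : B),
       star (act x a) ** b = star a ** act (star x) b)
    (H : hilbertType R[i]) (D : denseSubspace H)
    (rho : starRep B D) (rho_nd : nondegenerate_rep rho) :
  exists! rhot : starRep X (rep_range_domain rho_nd),
    forall (x : X) (b : B) (phi : domain D),
      rhot x (range_elt rho_nd b phi) = range_elt rho_nd (act x b) phi.
Proof.
exists (induced_rep rho_nd actM act_star).
split=> [x b phi|s sE]; first exact: induced_fun_elt.
(* Uniqueness: the formula fixes each linear operator [s x] on generators, hence on their span. *)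
apply: starRepP => x; apply: Lplus_range_ext => b phi.
by rewrite sE; apply: induced_fun_elt.
Qed.
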